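(* Let $X=\{X_t\}_{t\ge 0}$ be a Markov chain on $(\mathsf X,\mathscr X)$ with transition kernel $Q$ which is $\psi$-irreducible, aperiodic and positive Harris recurrent, $\pi$-reversible for a probability measure $\pi$, and geometrically ergodic, and let $g:\mathsf X\to\mathbb R$ satisfy $\int g(x)^2\pi(dx)<\infty$. Let $\gamma(k)=\mathrm{Cov}_\pi(g(X_0),g(X_{|k|}))$, $k\in\mathbb Z$, and let $F$ be the representing measure for $\gamma$, i.e. the measure supported in $[-1,1]$ with $\gamma(k)=\int x^{|k|}F(dx)$ for all $k\in\mathbb Z$. Suppose $\delta\in(0,1]$ is chosen so that $F$ is supported on $[-1+\delta,1-\delta]$. Let $r_M$ be an initial autocovariance sequence estimator satisfying conditions (R.1)–(R.3) of the context. Put $$\sigma^2(\gamma)=\sum_{k\in\mathbb Z}\gamma(k),\qquad \sigma^2(\Pi_\delta(r_M))=\sum_{k\in\mathbb Z}\Pi_\delta(r_M)(k).$$ Then, for each initial condition $x\in\mathsf X$, $\sigma^2(\Pi_\delta(r_M))\to\sigma^2(\gamma)$ $P_x$-almost surely as $M\to\infty$.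
   Context: **Markov chain.** $\mathsf X$ is a complete separable metric space with Borel $\sigma$-algebra $\mathscr X$. $P_\nu$ (resp. $P_x$) is the law on the canonical sequence space of the chain with kernel $Q$ and initial distribution $\nu$ (resp. started at $x$); $\mathrm{Cov}_\pi$ is covariance under $P_\pi$. $Q$ is $\pi$-reversible if $\int f_1\,(Qf_2)\,d\pi=\int (Qf_1)\,f_2\,d\pi$ for all $f_1,f_2\in L^2(\pi)$, where $Qf(x)=\int Q(x,dy)f(y)$. Geometric ergodicity: there are $\rho<1$ and a non-negative (finite) function $V$ on $\mathsf X$ with $\|Q^n(x,\cdot)-\pi\|_{\mathrm{TV}}\le V(x)\rho^n$ for all $x\in\mathsf X$ and all $n$. $\psi$-irreducibility, aperiodicity and positive Harris recurrence are in the sense of Meyn and Tweedie. **Moment sequences.** $\ell_2(\mathbb Z)$ is the space of square-summable real sequences on $\mathbb Z$, with norm $\|\cdot\|$. $\mathscr M_\infty(\delta)$ is the set of $m\in\mathbb R^{\mathbb Z}$ for which there is a positive measure $\mu$ (a representing measure) supported on $[-1+\delta,1-\delta]$ with $m(k)=\int x^{|k|}\mu(dx)$ for all $k\in\mathbb Z$ (convention $0^0=1$). For $r\in\ell_2(\mathbb Z)$, $\Pi_\delta(r)=\arg\min_{m\in\mathscr M_\infty(\delta)\cap\ell_2(\mathbb Z)}\|r-m\|^2$ (it exists and is unique). **Conditions on the initial estimator.** For each $M$, $r_M=\{r_M(k)\}_{k\in\mathbb Z}$ is a real sequence computed from $X_0,\dots,X_{M-1}$ such that: (R.1) for each $k\in\mathbb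 Z$, $r_M(k)\to\gamma(k)$ as $M\to\infty$, $P_x$-a.s., for any $x\in\mathsf X$; (R.2) $r_M(k)=0$ for $k\ge n(M)$, for some $n(M)<\infty$; (R.3) $r_M(k)=r_M(-k)$ and $r_M(0)\ge |r_M(k)|$ for each $k\in\mathbb Z$. *)

(* Defs.v *)
From HB Require Import structures.
From mathcomp Require Import all_boot all_order all_algebra.
From mathcomp Require Import all_classical all_reals all_analysis.

Set Implicit Arguments.
Unset Strict Implicit.
Unset Printing Implicit Defensive.

Import Order.TTheory GRing.Theory Num.Theory.
Import numFieldNormedType.Exports.

Local Open Scope classical_set_scope.
Local Open Scope ring_scope.
Local Open Scope ereal_scope.

(* The library's [completePseudoMetricType] does not ask that points at
   distance zero coincide, hence this join with [Metric]. *)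
#[short(type="completeMetricType")]
HB.structure Definition CompleteMetric (R : numDomainType) :=
  {T of Metric R T & Complete T}.

Definition separable (T : topologicalType) : Prop :=
  exists2 D : set T, countable D & dense D.

Definition borel {R : realType} (X : completeMetricType R) :=
  g_sigma_algebraType (@open X).

Section canonical_space.
Context d (T : measurableType d).

Definition coordinate_cylinders : set (set (nat -> T)) :=
  [set C | exists (n : nat) (A : set T),
     measurable A /\ C = [set w | A (w n)]].

Definition path_space := g_sigma_algebraType coordinate_cylinders.

Definition coord (n : nat) (w : path_space) : T := (w : nat -> T) n.

Definition initial_segment (M : nat) (w : path_space) : M.-tuple T :=
  [tuple coord i w | i < M].

End canonical_space.
Arguments coord {d T} n w.
Arguments initial_segment {d T} M w.

Section markov_chain.
Context d (T : measurableType d) (R : realType).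
Variable Q : R.-pker T ~> T.

Fixpoint visit_prob (s : seq (set T)) (x : T) : \bar R :=
  if s is A :: s' then \int[Q x]_(y in A) visit_prob s' y else 1.

(* The finite-dimensional distributions
     Pr (X_0 in A_0, ..., X_n in A_n)
       = \int_{A_0} nu(dx_0) \int_{A_1} Q(x_0, dx_1) ... \int_{A_n} Q(x_{n-1}, dx_n)
   determine Pr uniquely, the cylinders being a pi-system that generates the
   sigma-algebra of the path space. *)
Definition chain_law (nu : probability T R)
    (Pr : probability (path_space T) R) : Prop :=
  forall (A0 : set T) (s : seq (set T)),
    measurable A0 -> (forall i, (i < size s)%N -> measurable (nth setT s i)) ->
    Pr [set w | A0 (coord 0 w) /\
          forall i, (i < size s)%N -> nth setT s i (coord i.+1 w)]
    = \int[nu]_(x in A0) visit_prob s x.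

Fixpoint kernel_iter (n : nat) (x : T) (A : set T) : \bar R :=
  if n is n'.+1 then \int[Q x]_y kernel_iter n' y A else \d_x A.

Definition invariant_measure (pi : probability T R) : Prop :=
  forall A, measurable A -> \int[pi]_x Q x A = pi A.

Definition transition (f : T -> R) (x : T) : R := (\int[Q x]_y f y)%R.

Definition reversible (pi : probability T R) : Prop :=
  forall f1 f2 : T -> R, f1 \in Lfun pi 2%:E -> f2 \in Lfun pi 2%:E ->
    \int[pi]_x (f1 x * transition f2 x)%:E =
    \int[pi]_x (transition f1 x * f2 x)%:E.

(* This is half of the norm sup_{|f| <= 1} |mu f - nu f|; the choice between
   the two is immaterial in [geometrically_ergodic], where it rescales V. *)
Definition tv_dist (mu nu : set T -> \bar R) : \bar R :=
  ereal_sup [set `|mu A - nu A| | A in measurable].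

Definition geometrically_ergodic (pi : probability T R) : Prop :=
  exists (rho : R) (V : T -> R),
    [/\ (rho < 1)%R, forall x, (0 <= V x)%R &
        forall x n, tv_dist (kernel_iter n x) pi <= (V x * rho ^+ n)%:E].

Section stability.
(* P nu is the law of the chain started from nu, so that P \d_x is P_x. *)
Variable P : probability T R -> probability (path_space T) R.

Definition irreducible_for (phi : {sigma_finite_measure set T -> \bar R}) :
    Prop :=
  0 < phi setT /\
  forall A, measurable A -> 0 < phi A ->
    forall x, 0 < P \d_x [set w | exists n, A (coord n.+1 w)].

(* Following Meyn and Tweedie, psi is moreover a maximal irreducibility
   measure. *)
Definition psi_irreducible (psi : {sigma_finite_measure set T -> \bar R}) :
    Prop :=
  irreducible_for psi /\
  forall phi : {sigma_finite_measure set T -> \bar R},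
    irreducible_for phi -> phi `<< psi.

Definition harris_recurrent_set (A : set T) : Prop :=
  forall x, A x -> P \d_x (lim_sup_set (fun n => [set w | A (coord n w)])) = 1.

Definition harris_recurrent (psi : {sigma_finite_measure set T -> \bar R}) :
    Prop :=
  psi_irreducible psi /\
  forall A, measurable A -> 0 < psi A -> harris_recurrent_set A.

Definition positive_harris_recurrent
    (psi : {sigma_finite_measure set T -> \bar R}) : Prop :=
  harris_recurrent psi /\ exists pi : probability T R, invariant_measure pi.

End stability.

Definition cyclic_decomposition (psi : {sigma_finite_measure set T -> \bar R}) (p : nat)
    (D : nat -> set T) : Prop :=
  [/\ (0 < p)%N,
      forall i, (i < p)%N -> measurable (D i),
      forall i j, (i < p)%N -> (j < p)%N -> i <> j -> D i `&` D j = set0,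
      forall i x, (i < p)%N -> D i x -> Q x (D (i.+1 %% p)%N) = 1 &
      psi (~` \bigcup_(i in `I_p) D i) = 0].

Definition is_period (psi : {sigma_finite_measure set T -> \bar R}) (p : nat) :
    Prop :=
  (exists D, cyclic_decomposition psi p D) /\
  forall p' D, cyclic_decomposition psi p' D -> (p' <= p)%N.

Definition aperiodic (psi : {sigma_finite_measure set T -> \bar R}) : Prop :=
  is_period psi 1.

End markov_chain.

Definition autocov d (T : measurableType d) (R : realType)
    (Ppi : probability (path_space T) R) (g : T -> R) (k : int) : R :=
  fine (covariance Ppi (g \o coord 0) (g \o coord `|k|%N)).

Section moment_sequences.
Context {R : realType}.

Definition supported_on (mu : {measure set R -> \bar R}) (a b : R) : Prop :=
  mu (~` `[a, b]) = 0.

Definition represents (mu : {measure set R -> \bar R}) (m : int -> R) : Prop :=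
  forall k, (m k)%:E = \int[mu]_x (x ^+ `|k|%N)%:E.

Definition moment_seqs (delta : R) : set (int -> R) :=
  [set m | exists mu : {measure set R -> \bar R},
     supported_on mu (-1 + delta)%R (1 - delta)%R /\ represents mu m].

Definition sqnorm (r : int -> R) : \bar R :=
  \esum_(k in [set: int]) (r k ^+ 2)%:E.

Definition ell2 : set (int -> R) := [set r | sqnorm r < +oo].

Definition is_projection (delta : R) (r m : int -> R) : Prop :=
  (moment_seqs delta `&` ell2) m /\
  forall m', (moment_seqs delta `&` ell2) m' ->
    sqnorm (r \- m)%R <= sqnorm (r \- m')%R.

(* The minimizer exists and is unique when r is in ell2; the default value 0 is
   only returned outside that case. *)
Definition moment_projection (delta : R) (r : int -> R) : int -> R :=
  xget (fun=> 0%R) (is_projection delta r).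

(* Sum over int as the integral against the counting measure: the sum of the
   positive part minus the sum of the negative part. *)
Definition zsum (a : int -> R) : R :=
  fine (\esum_(k in [set: int]) (EFin \o a)^\+ k -
        \esum_(k in [set: int]) (EFin \o a)^\- k).

End moment_sequences.

(* Main.v *)
Require Import Defs.
From HB Require Import structures.
From mathcomp Require Import all_boot all_order all_algebra.
From mathcomp Require Import all_classical all_reals all_analysis.
From mathcomp Require Import measurable_realfun.
From mathcomp Require Import ring lra.

Set Implicit Arguments.
Unset Strict Implicit.
Unset Printing Implicit Defensive.

Import Order.TTheory GRing.Theory Num.Theory.
Import numFieldNormedType.Exports.

Local Open Scope classical_set_scope.
Local Open Scope ring_scope.

(* The moment sequence gamma lies in the convex cone M of the projection, so for
   m_M = Pi_delta(r_M) the variational inequality <r_M - m_M, gamma - m_M> <= 0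
   gives ||gamma - m_M||^2 <= <gamma - r_M, gamma - m_M>.  The same inequality
   with 0 in place of gamma bounds the mass m_M(0) by a constant times r_M(0).
   Every element of M decays geometrically at rate 1 - delta, so the right-hand
   side tends to 0 by dominated convergence; hence m_M -> gamma pointwise, and
   dominated convergence again yields convergence of the sums.

   The minimizer defining Pi_delta exists because a minimizing sequence has
   bounded mass: each measure is a multiple of the law of a monotone quantile
   function on ]0, 1], and an ultrafilter limit of quantile functions is again
   monotone.  Dominated convergence fails along an ultrafilter, but Riemann sums
   of monotone functions converge uniformly, which is enough for the moments. *)

(** * Quantile representation of moment sequences *)

Section power.
Context {R : realDomainType}.

(** When [x - y] is factored out of [x ^+ k - y ^+ k], the cofactor is a sum of [k] terms of
    absolute value at most 1. *)
Lemma lipschitz_exprn (x y : R) k : `|x| <= 1 -> `|y| <= 1 ->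
  `|x ^+ k - y ^+ k| <= k%:R * `|x - y|.
Proof.
move=> x1 y1; rewrite subrXX normrM mulrC ler_wpM2r//.
apply: (le_trans (ler_norm_sum _ _ _)).
rewrite -[X in _ <= X%:R]card_ord -sumr_const.
apply: ler_sum => i _; rewrite normrM !normrX.
by rewrite mulr_ile1// exprn_ile1.
Qed.

End power.

(** * The uniform law on ]0, 1] and Riemann sums of monotone functions *)

Section uniform01.
Context {R : realType}.

Definition unif01 : probability (measurableTypeR R) R :=
  uniform_prob (@ltr01 R).

Lemma unif01_itv (c d : R) : 0 <= c -> c <= d -> d <= 1 ->
  unif01 `]c, d]%classic = (d - c)%:E.
Proof.
move=> c0 cd d1; rewrite /unif01/= /uniform_prob.
rewrite (eq_integral (fun=> 1%E)); last first.
  move=> x; rewrite inE/= in_itv/= => /andP[cx xd].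
  rewrite /uniform_pdf (le_trans c0 (ltW cx)) (le_trans xd d1)/=.
  by rewrite subr0 invr1.
rewrite integral_cst//= mul1e lebesgue_measure_itv/= lte_fin.
case: ltP => [_|dc]; first by rewrite -EFinD.
by have -> : d = c; [apply/eqP; rewrite eq_le dc cd|rewrite subrr].
Qed.

Lemma unif01_setC : unif01 (~` `]0, 1]%classic) = 0%E.
Proof. by rewrite probability_setC// unif01_itv// subr0 subee. Qed.

Lemma unif01_full (A : set R) : measurable A ->
  unif01 A = unif01 (A `&` `]0, 1]%classic).
Proof.
move=> mA.
have m01 : measurable (`]0, 1]%classic : set (measurableTypeR R)) by [].
rewrite [LHS](measureDI unif01 mA m01) [X in (X + _)%E](_ : _ = 0%E) ?add0e//.
apply/eqP; rewrite eq_le measure_ge0 andbT -unif01_setC; apply: le_measure.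
- by rewrite inE; exact: measurableD.
- by rewrite inE; exact: measurableC.
- by move=> x [].
Qed.

Lemma nondecreasing_measurableR (D : set (measurableTypeR R)) (q : R -> R) :
  measurable D -> {homo q : x y / x <= y} ->
  measurable_fun D (q : measurableTypeR R -> R).
Proof. by move=> mD qm; exact: nondecreasing_measurable. Qed.

Section monotone.
Variable q : R -> R.
Hypotheses (q_mono : {homo q : x y / x <= y}) (q1 : forall u, `|q u| <= 1).

Lemma integrable_exprn (D : set (measurableTypeR R)) k : measurable D ->
  unif01.-integrable D (EFin \o (fun u => q u ^+ k)).
Proof.
move=> mD; apply: measurable_bounded_integrable => //.
- by rewrite (le_lt_trans (probability_le1 _ mD))// ltry.
- apply: measurable_funX; exact: nondecreasing_measurableR.
- exists 1; split; rewrite ?num_real// => x x1 u _ /=.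
  by rewrite normrX (le_trans _ (ltW x1))// exprn_ile1.
Qed.

(** Restricting to the first [n] cells makes induction on [n] possible. On a cell []c, d]],
    monotonicity and the Lipschitz bound for powers give an error of at most [k * (q d - q c)] times
    the cell length, and the increments telescope. Only the total increase of [q] enters, hence the
    uniformity in [q]. *)
Lemma riemann_sum_le k N n : (n <= N.+1)%N ->
  `|\int[unif01]_(u in `]0, (n%:R / N.+1%:R)]) (q u ^+ k)
    - N.+1%:R^-1 * \sum_(i < n) q (i.+1%:R / N.+1%:R) ^+ k|
  <= k%:R / N.+1%:R * (q (n%:R / N.+1%:R) - q 0).
Proof.
elim: n => [_|n IH nN].
  rewrite mul0r set_itv_ge ?bnd_simp ?ltxx// Rintegral_set0 big_ord0.
  by rewrite mulr0 !subrr normr0 mulr0.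
have N0 : (0 : R) < N.+1%:R by rewrite ltr0n.
have nn : n%:R / N.+1%:R <= n.+1%:R / N.+1%:R :> R.
  by rewrite ler_pM2r ?invr_gt0// ler_nat.
have n0 : 0 <= n%:R / N.+1%:R :> R by rewrite divr_ge0.
have n1 : n.+1%:R / N.+1%:R <= 1 :> R by rewrite ler_pdivrMr// mul1r ler_nat.
set c := n%:R / N.+1%:R in nn n0 *; set d := n.+1%:R / N.+1%:R in nn n1 *.
have dc : d - c = N.+1%:R^-1 by rewrite /d /c -mulrBl -natrB// subSnn mul1r.
have -> : `]0, d]%classic = `]0, c]%classic `|` `]c, d]%classic.
  by rewrite -(@itv_bndbnd_setU _ _ (BRight 0) (BRight c) (BRight d))// bnd_simp.
rewrite (@Rintegral_setU _ _ _ unif01)//; first last.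
- apply/disj_setPS => x [] /=; rewrite !in_itv/= => /andP[_ xc] /andP[cx _].
  by have := le_lt_trans xc cx; rewrite ltxx.
- by apply: integrable_exprn; exact: measurableU.
rewrite big_ord_recr/= mulrDr -/d.
set A := (X in `|X + _ - _|); set B := (X in `|_ + X - _|).
set S := (X in _ - (X + _)); set x := q d ^+ k.
have -> : A + B - (S + N.+1%:R^-1 * x) = (A - S) + (B - N.+1%:R^-1 * x).
  by rewrite opprD addrACA.
apply: (le_trans (ler_normD _ _)).
have -> : q d - q 0 = (q c - q 0) + (q d - q c) by rewrite [RHS]addrC addrA subrK.
rewrite mulrDr lerD//; first exact/IH/ltnW.
have mcd : measurable (`]c, d]%classic : set (measurableTypeR R)) by [].
have Ucd : fine (unif01 `]c, d]%classic) = N.+1%:R^-1 by rewrite unif01_itv// dc.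
have icst y : unif01.-integrable `]c, d]%classic (EFin \o cst y).
  apply: measurable_bounded_integrable => //.
    by rewrite (le_lt_trans (probability_le1 _ mcd))// ltry.
  exact: bounded_cst.
have -> : N.+1%:R^-1 * x = \int[unif01]_(u in `]c, d]) x.
  by rewrite Rintegral_cst// Ucd mulrC.
rewrite /B -RintegralB//; [|exact: integrable_exprn|exact: icst].
have iB : unif01.-integrable `]c, d]%classic (EFin \o (fun u => q u ^+ k - x)).
  rewrite (_ : _ \o _ = ((EFin \o (fun u => q u ^+ k)%R) \- (EFin \o cst x))%E)//.
  by apply: integrableB; [|exact: integrable_exprn|exact: icst].
apply: (le_trans (le_normr_Rintegral mcd iB)).
have -> : k%:R / N.+1%:R * (q d - q c) =
    \int[unif01]_(u in `]c, d]) (k%:R * (q d - q c)).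
  by rewrite Rintegral_cst// Ucd mulrAC.
apply: le_Rintegral => //; [|exact: icst|].
  exact: (integrable_abse iB).
move=> u /=; rewrite in_itv/= => /andP[cu ud].
apply: (le_trans (lipschitz_exprn _ (q1 _) (q1 _))).
rewrite ler_wpM2l// distrC ger0_norm ?subr_ge0 ?q_mono//.
by rewrite lerD2l lerN2 q_mono// ltW.
Qed.

End monotone.
End uniform01.

(** * Moments of monotone functions under pointwise limits along a filter *)

Section quantile_limits.
Context {R : realType}.

Lemma cvg_big_sum (I J : Type) (F : set_system I) (FF : Filter F) (s : seq J)
    (f : I -> J -> R) (l : J -> R) :
  (forall j, f i j @[i --> F] --> l j) ->
  \sum_(j <- s) f i j @[i --> F] --> \sum_(j <- s) l j.
Proof.
move=> fl; elim: s => [|j s IH].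
  by rewrite big_nil; under eq_fun do rewrite big_nil; exact: cvg_cst.
by rewrite big_cons; under eq_fun do rewrite big_cons; apply: cvgD.
Qed.

Lemma cvg_exprn (I : Type) (F : set_system I) (FF : Filter F)
    (f : I -> R) (l : R) k :
  f i @[i --> F] --> l -> f i ^+ k @[i --> F] --> l ^+ k.
Proof. 
move=> fl; elim: k => [|k IH]; first by rewrite expr0; exact: cvg_cst.
by rewrite exprS; under eq_fun do rewrite exprS; exact: cvgM.
Qed.

(** Both integrals are within [e / 4] of their Riemann sums, uniformly in [i]. The sums involve
    finitely many nodes, so pointwise convergence along any filter suffices for them. *)
Lemma cvg_integral_exprn (I : Type) (F : set_system I) (FF : Filter F)
    (q : I -> R -> R) (Q : R -> R) k :
  (forall i, {homo q i : x y / x <= y}) -> (forall i u, `|q i u| <= 1) ->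
  {homo Q : x y / x <= y} -> (forall u, `|Q u| <= 1) ->
  (forall u, q i u @[i --> F] --> Q u) ->
  \int[unif01]_(u in `]0, 1]) (q i u ^+ k) @[i --> F] -->
  \int[unif01]_(u in `]0, 1]) (Q u ^+ k).
Proof.
move=> qm q1 Qm Q1 qQ; apply/cvgrPdist_le => e e0.
(* A monotone function with values in [-1, 1] increases by at most 2 in total, so this mesh brings
   the Riemann error below [e / 4]. *)
pose N := Num.truncn (8 * k%:R / e).
have N0 : (0 : R) < N.+1%:R by rewrite ltr0n.
have kN : 2 * k%:R / N.+1%:R <= e / 4 :> R.
  rewrite ler_pdivrMr//.
  have := truncnS_gt (8 * k%:R / e); rewrite -/N ltr_pdivrMr//; lra.
pose S (f : R -> R) := N.+1%:R^-1 * \sum_(i < N.+1) f (i.+1%:R / N.+1%:R) ^+ k.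
have SE f : {homo f : x y / x <= y} -> (forall u, `|f u| <= 1) ->
    `|\int[unif01]_(u in `]0, 1]) (f u ^+ k) - S f| <= e / 4.
  move=> fm f1; have := riemann_sum_le fm f1 k (leqnn N.+1).
  rewrite divff ?gt_eqF// -/(S f) => /le_trans; apply.
  apply: le_trans kN; rewrite [leRHS](_ : _ = k%:R / N.+1%:R * 2); last by ring.
  rewrite ler_wpM2l ?divr_ge0//.
  by have := f1 1; have := f1 0; rewrite !ler_norml; lra.
have Scvg : S (q i) @[i --> F] --> S Q.
  by rewrite /S; apply: cvgM; [exact: cvg_cst|]; apply: cvg_big_sum => j; exact: cvg_exprn.
have e2 : 0 < e / 2 by rewrite divr_gt0.
move/cvgrPdist_le: Scvg => /(_ _ e2); apply: filterS => i.
have := SE _ (qm i) (q1 i); have := SE _ Qm Q1.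
move: (S Q) (S _) => s t; move: (Rintegral _ _ _) (Rintegral _ _ _) => x y.
by rewrite !ler_norml; lra.
Qed.

End quantile_limits.

(** * Laws of quantile functions and their moments *)

Section quantile_measure.
Context {R : realType}.

Lemma integral_mscale d (T : measurableType d) (m : {measure set T -> \bar R})
    (c : {nonneg R}) (f : T -> \bar R) : m.-integrable setT f ->
  (\int[mscale c m]_x f x = c%:num%:E * \int[m]_x f x)%E.
Proof.
move=> mf; rewrite [LHS]integralE [in RHS]integralE.
have /integrableP[mmf _] := mf.
rewrite ge0_integral_mscale//; last exact: measurable_funepos.
rewrite ge0_integral_mscale//; last exact: measurable_funeneg.
rewrite [RHS]muleBr//.
apply: fin_num_adde_defr; rewrite ?fin_numN; apply: integrable_fin_num => //.
exact: integrable_funepos.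
Qed.

Lemma unif01_integral (q : R -> R) k : {homo q : x y / x <= y} ->
  (forall u, `|q u| <= 1) ->
  (\int[unif01]_u (q u ^+ k)%:E)%E = (\int[unif01]_(u in `]0%R, 1%R]) (q u ^+ k))%:E.
Proof.
move=> qm q1.
rewrite /Rintegral fineK; last first.
  apply: integrable_fin_num => //; exact: integrable_exprn.
have m01 : measurable (`]0, 1]%classic : set (measurableTypeR R)) by [].
rewrite (negligible_integral (measurableC m01))//.
- by rewrite setTD setCK.
- exact: integrable_exprn.
- exact: unif01_setC.
Qed.

Definition quantile_law (q : R -> R) (qm : {homo q : x y / x <= y}) :
    probability R R :=
  distribution unif01 (MeasurableFun.Pack (MeasurableFun.Class
    (isMeasurableFun.Build _ _ _ _ _
      (nondecreasing_measurableR (@measurableT _ (measurableTypeR R)) qm)))).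

Lemma integral_quantile_law q (qm : {homo q : x y / x <= y}) k :
  (forall u, `|q u| <= 1) ->
  (quantile_law qm).-integrable setT (fun x => (x ^+ k)%:E) /\
  (\int[quantile_law qm]_x (x ^+ k)%:E =
   (\int[unif01]_(u in `]0%R, 1%R]) (q u ^+ k))%:E)%E.
Proof.
move=> q1.
have mX : measurable_fun setT (fun x : R => (x ^+ k)%:E).
  by apply/measurable_EFinP; exact: measurable_funX.
have iq : unif01.-integrable setT (fun u => (q u ^+ k)%:E).
  exact: integrable_exprn.
split; first exact: integrable_pushforward.
by rewrite integral_distribution//= unif01_integral.
Qed.

(** A converse to [moments_quantile]: it shows that a limit of quantile representations is again a
    moment sequence. *)
Lemma quantile_moments (a b K : R) (q : R -> R) :
  -1 <= a -> b <= 1 -> 0 <= K -> {homo q : x y / x <= y} ->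
  (forall u, a <= q u <= b) ->
  exists mu : {measure set R -> \bar R}, supported_on mu a b /\
    represents mu (fun k => K * \int[unif01]_(u in `]0, 1]) (q u ^+ `|k|%N)).
Proof.
move=> a1 b1 K0 qm qab.
have q1 u : `|q u| <= 1 by have /andP[? ?] := qab u; rewrite ler_norml; lra.
exists (mscale (NngNum K0) (quantile_law qm)); split.
  suff q0 : quantile_law qm (~` `[a, b]) = 0%E.
    by change (K%:E * quantile_law qm (~` `[a, b]) = 0)%E; rewrite q0 mule0.
  rewrite /quantile_law/= /distribution /pushforward/=.
  rewrite (_ : _ @^-1` _ = set0) ?measure0//.
  by apply/seteqP; split => // u /=; apply; rewrite in_itv/=.
move=> k; have [intq intqE] := integral_quantile_law qm `|k|%N q1.
by rewrite integral_mscale// intqE.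
Qed.

End quantile_measure.

(** * From a measure on a compact interval to a quantile function *)

Section quantile_representation.
Context {R : realType}.

(** The complementary rays []x, +oo[] form a pi-system generating the Borel sets. *)
Lemma eq_probability_itvNyc (P1 P2 : probability R R) :
  (forall t, P1 `]-oo, t]%classic = P2 `]-oo, t]%classic) ->
  forall A, measurable A -> P1 A = P2 A.
Proof.
move=> P12.
have P12' x : P1 `]x, +oo[%classic = P2 `]x, +oo[%classic.
  by rewrite -setCitvl !probability_setC// P12.
apply: (measure_unique (@RGenOInfty.G R) (fun n => `]- n%:R, +oo[%classic)).
- exact: RGenOInfty.measurableE.
- move=> _ _ [x ->] [y ->]; exists (Num.max x y).
  by apply/seteqP; split => z /=; rewrite !in_itv/= !andbT gt_max => /andP.
- by move=> n; exists (- n%:R).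
- apply/seteqP; split => // x _; exists (Num.truncn `|x|).+1 => //=.
  rewrite in_itv/= andbT ltrNl (le_lt_trans _ (truncnS_gt _))//.
  by rewrite -normrN ler_norm.
- by move=> _ [x ->]; exact: P12'.
- by move=> n; rewrite (le_lt_trans (probability_le1 _ _))// ltry.
Qed.

(** [q] is the generalized inverse of the distribution function [G] of [P]. Inside []0, 1]] the
    condition [q u <= t] defines []0, G t]], which identifies the law. *)
Lemma probability_quantile (P : probability R R) (a b : R) : a <= b ->
  P (~` `[a, b]%classic) = 0%E ->
  exists (q : R -> R) (qm : {homo q : x y / x <= y}),
    (forall u, a <= q u <= b) /\
    forall A, measurable A -> P A = quantile_law qm A.
Proof.
move=> ab Pab.
have P0 A : measurable A -> A `<=` ~` `[a, b]%classic -> P A = 0%E.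
  move=> mA Aab; apply/eqP; rewrite eq_le measure_ge0 andbT -Pab le_measure//.
    by rewrite inE.
  by rewrite inE; exact: measurableC.
pose G t := fine (P `]-oo, t]%classic).
have GE t : P `]-oo, t]%classic = (G t)%:E.
  by rewrite /G fineK// fin_num_measure.
have Gm : {homo G : x y / x <= y}.
  move=> x y xy; rewrite -lee_fin -!GE le_measure ?inE//.
  by apply: subset_itvl; rewrite bnd_simp.
have G0 t : 0 <= G t by rewrite -lee_fin -GE.
have G1 t : G t <= 1 by rewrite -lee_fin -GE probability_le1.
have Ga t : t < a -> G t = 0.
  move=> ta; rewrite /G P0// => x /=; rewrite !in_itv/= => xt /andP[ax _].
  by have := le_lt_trans ax (le_lt_trans xt ta); rewrite ltxx.
have Gb t : b <= t -> G t = 1.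
  move=> bt; rewrite /G -setCitvr probability_setC// P0 ?sube0// => x /=.
  rewrite !in_itv/= andbT => tx /andP[_ xb].
  by have := lt_le_trans tx (le_trans xb bt); rewrite ltxx.
have Gr t : G s @[s --> t^'+] --> G t.
  have mid : measurable_fun setT (fun x : R => x) by exact: measurable_id.
  have := @cdf_right_continuous _ _ _ P
    (MeasurableFun.Pack (MeasurableFun.Class (isMeasurableFun.Build _ _ _ _ _ mid))) t.
  rewrite /cdf /distribution /pushforward/= => PG.
  by apply: fine_cvg; rewrite fineK ?fin_num_measure//; exact: PG.
(* The clause [t = b] keeps the set nonempty for u > 1, so that its infimum is
   monotone in every real u. *)
pose E u := [set t : R | a <= t <= b /\ (t = b \/ u <= G t)].
have Eb u : E u b by split; [rewrite ab lexx|left].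
have Ea u : lbound (E u) a by move=> t [/andP[]].
pose q u := inf (E u).
have qE u t : E u t -> q u <= t by move=> Et; apply: ge_inf => //; exists a.
have leq u t : lbound (E u) t -> t <= q u by move=> Et; apply: lb_le_inf => //; exists b.
have qm : {homo q : x y / x <= y}.
  move=> x y xy; apply: leq => t [tab tb]; apply: qE; split => //.
  by case: tb; [left|right; exact: le_trans xy _].
have qab u : a <= q u <= b by rewrite leq//= qE.
exists q, qm; split=> //.
apply: eq_probability_itvNyc => t; rewrite GE.
rewrite /quantile_law/= /distribution /pushforward/=.
have mq : measurable (q @^-1` `]-oo, t]%classic : set (measurableTypeR R)).
  rewrite -[X in measurable X]setTI.
  by apply: (nondecreasing_measurableR _ qm) => //; exact: measurable_itv.
rewrite [RHS](unif01_full mq).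
suff -> : q @^-1` `]-oo, t]%classic `&` `]0, 1]%classic = `]0, G t]%classic.
  by rewrite unif01_itv// subr0.
apply/seteqP; split => u /=; rewrite !in_itv/=.
- move=> [qut /andP[u0 u1]]; rewrite u0/= leNgt; apply/negP => Gtu.
  have tb : t < b by rewrite ltNge; apply/negP => /Gb Gt1; move: Gtu; rewrite Gt1 ltNge u1.
  (* As [G t < u], right continuity of [G] provides [s > t] with [s < b] and [G s < u]. Such an [s]
     is a lower bound of [E u], so [t < s <= q u <= t]. *)
  suff : \forall s \near t^'+, False by move=> /filter_ex[].
  near=> s.
  have ts : t < s by near: s; exact: nbhs_right_gt.
  have sb : s < b by near: s; exact: nbhs_right_lt.
  have Gs : G s < u by near: s; exact: (cvgr_lt _ (Gr t)).
  have : s <= q u.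
    apply: leq => v [_ [->|uGv]]; first exact: ltW.
    rewrite leNgt; apply/negP => /ltW /Gm vs.
    by have := lt_le_trans Gs (le_trans uGv vs); rewrite ltxx.
  by move=> /(lt_le_trans ts) /lt_le_trans /(_ qut); rewrite ltxx.
- move=> /andP[u0 uG]; rewrite u0 (le_trans uG (G1 t)); split=> //.
  have [bt|tb] := leP b t; first by apply: le_trans bt; have /andP[] := qab u.
  apply: qE; split; last by right.
  rewrite (ltW tb) andbT leNgt; apply/negP => /Ga Gt0.
  by have := lt_le_trans u0 uG; rewrite Gt0 ltxx.
Unshelve. all: by end_near. Qed.

Lemma moments_quantile (a b : R) (mu : {measure set R -> \bar R}) (m : int -> R) :
  -1 <= a -> a <= b -> b <= 1 -> supported_on mu a b -> represents mu m ->
  exists q : R -> R,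
    [/\ {homo q : x y / x <= y}, forall u, a <= q u <= b &
     forall k, m k = m 0 * \int[unif01]_(u in `]0, 1]) (q u ^+ `|k|%N)].
Proof.
move=> a1 ab b1 mus mum.
have muT : mu setT = (m 0)%:E.
  by rewrite mum; under eq_integral do rewrite expr0; rewrite integral_cst// mul1e.
have m0 : 0 <= m 0 by rewrite -lee_fin -muT.
have mX k : measurable_fun setT (fun x : R => (x ^+ k)%:E).
  by apply/measurable_EFinP; exact: measurable_funX.
(* With zero mass all moments vanish and any [q] will do. The case is separate because [mnormalize]
   then returns its default Dirac mass. *)
have [m00|m00] := eqVneq (m 0) 0.
  exists (fun=> a); split=> //; first by move=> u; rewrite lexx.
  move=> k; rewrite m00 mul0r; apply: EFin_inj; rewrite mum.
  by apply: null_set_integral => //; rewrite muT m00.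
pose P : probability R R := mnormalize mu (dirac (0 : R)).
have PE A : P A = (mu A * (m 0)^-1%:E)%E.
  by rewrite /P/= /mnormalize muT/= eqe (negbTE m00).
have /(probability_quantile ab)[q [qm [qab Pq]]] : P (~` `[a, b]%classic) = 0%E.
  by rewrite PE mus mul0e.
exists q; split=> // k; apply: EFin_inj.
have q1 u : `|q u| <= 1 by have /andP[? ?] := qab u; rewrite ler_norml; lra.
have [intq intqE] := integral_quantile_law qm `|k|%N q1.
rewrite EFinM -intqE (_ : m 0 = (NngNum m0)%:num)// -integral_mscale// mum.
apply: eq_measure_integral => A mA _.
change (mu A = (m 0)%:E * quantile_law qm A)%E.
by rewrite -Pq// PE muleCA -EFinM divff// mule1.
Qed.

End quantile_representation.

(** * The cone of moment sequences: convexity, decay and compactness *)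

Section moment_cone.
Context {R : realType}.

(** The integral is a difference of two extended reals, finite only if both terms are. This turns
    [represents], which equates integrals with real numbers, into integrability. *)
Lemma integrable_fin_integral d (T : measurableType d)
    (mu : {measure set T -> \bar R}) (f : T -> \bar R) :
  measurable_fun setT f -> (\int[mu]_x f x)%E \is a fin_num ->
  mu.-integrable setT f.
Proof.
move=> mf; rewrite integralE fin_numB => /andP[fp fn].
apply/integrableP; split => //.
rewrite (eq_integral (f^\+ \+ f^\-)%E); last first.
  by move=> x _; rewrite -[RHS]/((f^\+ \+ f^\-)%E x) -fune_abse.
rewrite ge0_integralD//; [|exact: measurable_funepos|exact: measurable_funeneg].
by rewrite lte_add_pinfty// -ge0_fin_numE//; apply: integral_ge0.
Qed.

(** Convex combinations serve as competitors in the variational inequality; [s = t = 0] yields the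
    zero sequence. *)
Lemma moment_seqs_comb (delta s t : R) (m f : int -> R) : 0 <= s -> 0 <= t ->
  moment_seqs delta m -> moment_seqs delta f ->
  moment_seqs delta (fun k => s * m k + t * f k).
Proof.
move=> s0 t0 [mu [mus mum]] [nu [nus nuf]].
pose ms : {measure set R -> \bar R} := mscale (NngNum s0) mu.
pose mt : {measure set R -> \bar R} := mscale (NngNum t0) nu.
exists (measure_add ms mt); split.
  have E : measure_add ms mt (~` `[-1 + delta, 1 - delta]%classic) = 0%E.
    rewrite measure_addE -[X in (X + _)%E]/(s%:E * mu _)%E.
    by rewrite -[X in (_ + X)%E]/(t%:E * nu _)%E mus nus !mule0 adde0.
  exact: E.
move=> k.
have mX : measurable_fun setT (fun x : R => (x ^+ `|k|%N)%:E).
  by apply/measurable_EFinP; exact: measurable_funX.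
have imu : mu.-integrable setT (fun x : R => (x ^+ `|k|%N)%:E).
  by apply: integrable_fin_integral => //; rewrite -mum.
have inu : nu.-integrable setT (fun x : R => (x ^+ `|k|%N)%:E).
  by apply: integrable_fin_integral => //; rewrite -nuf.
have Ems : (\int[ms]_x (x ^+ `|k|%N)%:E)%E = (s * m k)%:E.
  by rewrite /ms integral_mscale// -mum -EFinM.
have Emt : (\int[mt]_x (x ^+ `|k|%N)%:E)%E = (t * f k)%:E.
  by rewrite /mt integral_mscale// -nuf -EFinM.
rewrite integral_measure_add//.
- by rewrite Ems Emt.
- by apply: integrable_fin_integral => //; rewrite Ems.
- by apply: integrable_fin_integral => //; rewrite Emt.
Qed.

Lemma moment_seqs_quantile (delta : R) (m : int -> R) : 0 < delta <= 1 ->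
  moment_seqs delta m ->
  exists q : R -> R,
    [/\ {homo q : x y / x <= y}, forall u, -1 + delta <= q u <= 1 - delta &
     forall k, m k = m 0 * \int[unif01]_(u in `]0, 1]) (q u ^+ `|k|%N)].
Proof.
by move=> d01 [mu [mus mum]]; apply: moments_quantile mus mum; lra.
Qed.

Lemma moment_seqs_ge0 (delta : R) (m : int -> R) : moment_seqs delta m -> 0 <= m 0.
Proof.
by case=> mu [_ /(_ 0)]; rewrite -lee_fin => ->; apply: integral_ge0.
Qed.

Lemma moment_seqs_bound (delta : R) (m : int -> R) k : 0 < delta <= 1 ->
  moment_seqs delta m -> `|m k| <= m 0 * (1 - delta) ^+ `|k|%N.
Proof.
move=> d01 mM; have m0 := moment_seqs_ge0 mM.
have [q [qm qd ->]] := moment_seqs_quantile d01 mM.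
have q1 u : `|q u| <= 1 - delta by have := qd u; rewrite ler_norml; lra.
have q1' u : `|q u| <= 1 by apply: le_trans (q1 u) _; lra.
rewrite normrM ger0_norm// ler_wpM2l//.
have m01 : measurable (`]0, 1]%classic : set (measurableTypeR R)) by [].
have U1 : fine (unif01 `]0, 1]%classic) = 1 :> R by rewrite unif01_itv// subr0.
have iq := integrable_exprn qm q1' `|k|%N m01.
apply: (le_trans (le_normr_Rintegral m01 iq)).
have -> : (1 - delta) ^+ `|k|%N = \int[unif01]_(u in `]0%R, 1%R]) ((1 - delta) ^+ `|k|%N).
  by rewrite Rintegral_cst// U1 mulr1.
apply: le_Rintegral => //.
- exact: (integrable_abse iq).
- apply: measurable_bounded_integrable => //.
    by rewrite (le_lt_trans (probability_le1 _ m01))// ltry.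
  exact: bounded_cst.
- by move=> u _; rewrite normrX lerXn2r// nnegrE//; lra.
Qed.

(** Compactness gives a cluster point, and an ultrafilter converges to each of its cluster
    points. *)
Lemma bounded_ultra_cvg (I : Type) (U : set_system I) (UU : UltraFilter U)
    (f : I -> R) (B : R) : (forall i, `|f i| <= B) ->
  exists l : R, f i @[i --> U] --> l.
Proof.
move=> fB.
have fU : (f @ U) `[- B, B]%classic.
  apply: (@filterS _ U _ setT) filterT => i _.
  by rewrite /= in_itv/= -ler_norml.
have [l [_ lcl]] := @segment_compact R (- B) B (f @ U) _ fU.
exists l => A Al; have [//|UnA] := in_ultra_setVsetC (f @^-1` A) UU.
by have [x [nAx /nAx]] := lcl (~` A) A UnA Al.
Qed.

(** A single ultrafilter makes the masses and the values [q j u] converge for all real [u] at once,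
    with no diagonal extraction. As [U] refines [\oo], eventual statements pass to [U]. *)
Lemma moment_seqs_compact (delta : R) (m_ : nat -> int -> R) (B : R) :
  0 < delta <= 1 -> (forall j, moment_seqs delta (m_ j)) ->
  (forall j, m_ j 0 <= B) ->
  exists U : set_system nat, exists m : int -> R,
    [/\ ProperFilter U, \oo `<=` U, moment_seqs delta m &
      forall k, m_ j k @[j --> U] --> m k].
Proof.
move=> d01 mM mB.
have [U [UU ooU]] := @ultraFilterLemma nat \oo _.
have [q qE] := choice (fun j => moment_seqs_quantile d01 (mM j)).
have qm j : {homo q j : x y / x <= y} by have [] := qE j.
have qd j u : -1 + delta <= q j u <= 1 - delta by have [_ + _] := qE j.
have q1 j u : `|q j u| <= 1 by have := qd j u; rewrite ler_norml; lra.
have [Q Qq] := choice (fun u => bounded_ultra_cvg UU (fun j => q1 j u)).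
have [K mK] : exists K : R, m_ j 0 @[j --> U] --> K.
  apply: (@bounded_ultra_cvg _ _ UU _ B) => j.
  by rewrite ger0_norm//; exact: moment_seqs_ge0 (mM j).
have K0 : 0 <= K.
  by apply: (cvgr_to_ge mK); apply: nearW => j; exact: moment_seqs_ge0 (mM j).
have Qd u : -1 + delta <= Q u <= 1 - delta.
  by apply/andP; split; [apply: (cvgr_to_ge (Qq u))|apply: (cvgr_to_le (Qq u))];
    apply: nearW => j; have /andP[] := qd j u.
have Q1 u : `|Q u| <= 1 by have := Qd u; rewrite ler_norml; lra.
have Qm : {homo Q : x y / x <= y}.
  by move=> x y xy; apply: (ler_cvg_to (Qq x) (Qq y)); apply: nearW => j; exact: qm.
exists U, (fun k => K * \int[unif01]_(u in `]0, 1]) (Q u ^+ `|k|%N)); split=> //.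
- exact: ultra_proper.
- have lo : -1 <= -1 + delta by lra.
  have hi : 1 - delta <= 1 by lra.
  exact: (quantile_moments lo hi K0 Qm Qd).
- move=> k; have mE j : m_ j k = m_ j 0 * \int[unif01]_(u in `]0, 1]) (q j u ^+ `|k|%N).
    by have [_ _] := qE j.
  by under eq_fun do rewrite mE; apply: cvgM => //; exact: cvg_integral_exprn.
Qed.

End moment_cone.

(** * Geometrically dominated sums over the integers *)

Section geometric_domination.
Context {R : realType}.
Variable rho : R.
Hypothesis rho01 : 0 < rho < 1.

Lemma geometric_tail (u : R ^nat) (C : R) N j :
  (forall n, `|u n| <= C * rho ^+ n) ->
  `|series u (N + j)%N - series u N| <= C * rho ^+ N / (1 - rho).
Proof.
move=> uC.
have C0 : 0 <= C by have := le_trans (normr_ge0 _) (uC 0%N); rewrite expr0 mulr1.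
have /andP[r0 r1] := rho01.
have d0 : 0 < 1 - rho by lra.
(* Subtracting the remaining tail gives a bound that induction on [j] can carry. *)
suff : `|series u (N + j)%N - series u N| <=
    C * rho ^+ N / (1 - rho) - C * rho ^+ (N + j) / (1 - rho).
  move/le_trans; apply; rewrite gerBl divr_ge0 ?mulr_ge0 ?exprn_ge0 ?(ltW r0) ?(ltW d0)//.
elim: j => [|j IH]; first by rewrite addn0 !subrr normr0.
rewrite addnS seriesSr addrAC.
apply: (le_trans (ler_normD _ _)); apply: (le_trans (lerD IH (uC _))).
rewrite -addrA lerD2l exprS le_eqVlt; apply/orP; left; apply/eqP.
by field; rewrite gt_eqF.
Qed.

Lemma geometric_cvg (u : R ^nat) (C : R) :
  (forall n, `|u n| <= C * rho ^+ n) -> cvgn (series u).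
Proof.
move=> uC; apply: normed_cvg; have /andP[r0 r1] := rho01.
apply: (@series_le_cvg _ _ (geometric C rho)) => //.
- by move=> n /=; rewrite normr_ge0.
- by move=> n; exact: le_trans (normr_ge0 _) (uC n).
- by apply: is_cvg_geometric_series; rewrite ger0_norm// ltW.
Qed.

Lemma geometric_lim_tail (u : R ^nat) (C : R) N :
  (forall n, `|u n| <= C * rho ^+ n) ->
  `|limn (series u) - series u N| <= C * rho ^+ N / (1 - rho).
Proof.
move=> uC; have cu := geometric_cvg uC.
have : `|series u n - series u N| @[n --> \oo] --> `|limn (series u) - series u N|.
  by apply: cvg_norm; apply: cvgB => //; exact: cvg_cst.
move=> /cvgr_to_le; apply; near=> n.
have Nn : (N <= n)%N by near: n; exact: nbhs_infty_ge.
by rewrite -(subnKC Nn) geometric_tail.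
Unshelve. all: by end_near. Qed.

(** Dominated convergence for series: the tails beyond some [N] are at most [e / 4] uniformly in
    [M], which leaves finitely many terms. *)
Lemma tannery (u_ : nat -> R ^nat) (v : R ^nat) (C : R) :
  (forall M n, `|u_ M n| <= C * rho ^+ n) -> (forall n, `|v n| <= C * rho ^+ n) ->
  (forall n, u_ M n @[M --> \oo] --> v n) ->
  limn (series (u_ M)) @[M --> \oo] --> limn (series v).
Proof.
move=> uC vC uv; apply/cvgrPdist_le => e e0.
have /andP[r0 r1] := rho01.
have : C / (1 - rho) * rho ^+ N @[N --> \oo] --> (0 : R).
  rewrite -[X in _ --> X](mulr0 (C / (1 - rho))).
  apply: cvgM; first exact: cvg_cst.
  by apply: cvg_expr; rewrite ger0_norm// ltW.
have e4 : 0 < e / 4 by lra.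
move=> /cvgrPdist_le /(_ _ e4) /filter_ex[N].
rewrite sub0r normrN => /(le_trans (ler_norm _)) rN.
have : series (u_ M) N @[M --> \oo] --> series v N.
  rewrite /series/=; elim: N {rN} => [|N IH].
    by rewrite big_geq//; under eq_fun do rewrite big_geq//; exact: cvg_cst.
  by rewrite big_nat_recr//=; under eq_fun do rewrite big_nat_recr//=; exact: cvgD.
have e2 : 0 < e / 2 by lra.
move=> /cvgrPdist_le /(_ _ e2); apply: filterS => M.
have := geometric_lim_tail N (uC M); have := geometric_lim_tail N vC.
have -> : C * rho ^+ N / (1 - rho) = C / (1 - rho) * rho ^+ N by rewrite mulrAC.
move: (series (u_ M) N) (series v N) (limn _) (limn _) rN => a b c d.
move: (_ / _ * _) => x.
by rewrite !ler_norml; lra.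
Qed.

End geometric_domination.

(** * Sums over the integers as one-sided series *)

Section integer_sums.
Context {R : realType}.
Implicit Types a b : int -> R.

(** [Negz n] is [-(n + 1)], so these pairs cover each integer exactly once, 0 included. *)
Definition zfold a : R ^nat := fun n => a n + a (Negz n).

Definition zlim a : R := limn (series (zfold a)).

Lemma esum_int (f : int -> \bar R) : (forall k, (0 <= f k)%E) ->
  (\esum_(k in [set: int]) f k = \sum_(n <oo) (f n + f (Negz n)))%E.
Proof.
move=> f0; rewrite (esumID (range Posz))// !setTI.
have -> : ~` range Posz = range Negz.
  apply/seteqP; split => [[n|n] /= h|_ [n _ <-] [m _]]//.
  - by exfalso; apply: h; exists n.
  - by exists n.
rewrite (@reindex_esum _ _ _ setT _ Posz); last first.
  by split => // ? ? _ _ [].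
rewrite (@reindex_esum _ _ _ setT (range Negz) Negz); last first.
  by split => // ? ? _ _ [].
by rewrite -!nneseries_esumT// nneseriesD.
Qed.

Variable rho : R.
Hypothesis rho01 : 0 < rho < 1.

Definition geo_dominated a :=
  exists C, forall k, `|a k| <= C * rho ^+ `|k|%N.

Lemma zfold_le a C : (forall k, `|a k| <= C * rho ^+ `|k|%N) ->
  forall n, `|zfold a n| <= 2 * C * rho ^+ n.
Proof.
move=> aC n; have /andP[r0 r1] := rho01.
have C0 : 0 <= C by have := le_trans (normr_ge0 _) (aC 0); rewrite expr0 mulr1.
apply: (le_trans (ler_normD _ _)).
rewrite -mulrA mulr_natl mulr2n lerD//.
apply: (le_trans (aC _)); rewrite ler_wpM2l//= exprS ler_piMl ?exprn_ge0// ltW//.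
Qed.

Lemma zfold_cvg a : geo_dominated a -> cvgn (series (zfold a)).
Proof. by move=> [C /zfold_le]; exact: geometric_cvg. Qed.

Lemma esum_zlim a : geo_dominated a -> (forall k, 0 <= a k) ->
  (\esum_(k in [set: int]) (a k)%:E)%E = (zlim a)%:E.
Proof.
move=> ga a0; rewrite esum_int; last by move=> k; rewrite lee_fin.
rewrite /zlim -EFin_lim; last exact: zfold_cvg.
by congr (limn _); apply/funext => n /=; rewrite /series/= -sumEFin.
Qed.

Lemma geo_dominated_comb (s t : R) a b : geo_dominated a -> geo_dominated b ->
  geo_dominated (fun k => s * a k + t * b k).
Proof.
move=> [C aC] [D bD]; exists (`|s| * C + `|t| * D) => k.
rewrite mulrDl -!mulrA (le_trans (ler_normD _ _))// !normrM.
by rewrite lerD// ler_wpM2l.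
Qed.

Lemma zlim_comb (s t : R) a b : geo_dominated a -> geo_dominated b ->
  zlim (fun k => s * a k + t * b k) = s * zlim a + t * zlim b.
Proof.
move=> /zfold_cvg ca /zfold_cvg cb.
have -> : zlim (fun k => s * a k + t * b k) =
    limn (series (s *: zfold a + t *: zfold b)).
  congr (limn (series _)); apply/funext => n.
  rewrite -[RHS]/(s * (a n + a (Negz n)) + t * (b n + b (Negz n))).
  by rewrite /zfold !mulrDr addrACA.
rewrite lim_seriesD; [by rewrite !lim_seriesZ|exact: is_cvg_seriesZ..].
Qed.

Lemma le_zlim a b : geo_dominated a -> geo_dominated b ->
  (forall k, a k <= b k) -> zlim a <= zlim b.
Proof.
move=> ga gb ab; apply: lim_series_le => [||n]; [exact: zfold_cvg..|].
by rewrite lerD.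
Qed.

Lemma zlim_bound a C : (forall k, `|a k| <= C * rho ^+ `|k|%N) ->
  `|zlim a| <= 2 * C / (1 - rho).
Proof.
move=> aC; have := geometric_lim_tail rho01 0 (zfold_le aC).
by rewrite expr0 mulr1 /series/= big_geq// subr0.
Qed.

(** The positive and negative parts inherit the domination of [a]; linearity of [zlim] recombines
    them. *)
Lemma zsumE a : geo_dominated a -> zsum a = zlim a.
Proof.
move=> ga; have [C aC] := ga.
pose ap k := Num.max (a k) 0; pose an k := Num.max (- a k) 0.
have gp : geo_dominated ap.
  exists C => k; apply: le_trans (aC k).
  by rewrite /ap; case: (leP (a k) 0) => // ?; rewrite normr0.
have gn : geo_dominated an.
  exists C => k; apply: le_trans (aC k).
  by rewrite /an; case: (leP (- a k) 0) => // ?; rewrite ?normr0 ?normrN.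
rewrite /zsum.
have -> : (\esum_(k in [set: int]) (EFin \o a)^\+ k)%E = (zlim ap)%:E.
  rewrite -esum_zlim//; last by move=> k; rewrite le_max lexx orbT.
  by apply: eq_esum => k _; rewrite funeposE /ap EFin_max.
have -> : (\esum_(k in [set: int]) (EFin \o a)^\- k)%E = (zlim an)%:E.
  rewrite -esum_zlim//; last by move=> k; rewrite le_max lexx orbT.
  by apply: eq_esum => k _; rewrite funenegE /an EFin_max.
rewrite -EFinB/= -[zlim ap]mul1r -mulN1r -zlim_comb//.
congr zlim; apply/funext => k; rewrite mul1r mulN1r /ap /an.
by case: (leP (a k) 0); case: (leP (- a k) 0); lra.
Qed.

Lemma geo_dominatedM a b : geo_dominated a -> (exists B, forall k, `|b k| <= B) ->
  geo_dominated (fun k => a k * b k).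
Proof.
move=> [C aC] [B bB]; exists (C * B) => k.
by rewrite normrM mulrAC ler_pM.
Qed.

Lemma geo_dominated_bounded a : geo_dominated a -> exists B, forall k, `|a k| <= B.
Proof.
move=> [C aC]; exists C => k; apply: (le_trans (aC k)).
have C0 : 0 <= C by have := le_trans (normr_ge0 _) (aC 0); rewrite expr0 mulr1.
by have /andP[r0 r1] := rho01; rewrite ler_piMr// exprn_ile1// ltW.
Qed.

Lemma zlim_tannery (a_ : nat -> int -> R) b C :
  (forall M k, `|a_ M k| <= C * rho ^+ `|k|%N) ->
  (forall k, a_ M k @[M --> \oo] --> b k) ->
  zlim (a_ M) @[M --> \oo] --> zlim b.
Proof.
move=> aC ab.
have bC k : `|b k| <= C * rho ^+ `|k|%N.
  by apply: (cvgr_to_le (cvg_norm (ab k))); apply: nearW => M; exact: aC.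
apply: (@tannery _ rho rho01 _ _ (2 * C)) => [M||n].
- exact: zfold_le.
- exact: zfold_le.
- exact: cvgD.
Qed.

End integer_sums.

(** * The projection onto moment sequences *)

Section projection.
Context {R : realType}.
Variable delta : R.
Hypothesis delta01 : 0 < delta <= 1.

(* Rather than 1 - delta, which vanishes for delta = 1: a positive rate also
   dominates the finitely supported sequences r_M. *)
Let rho : R := 1 - delta / 2.

Let rho01 : 0 < rho < 1.
Proof. by have := delta01; rewrite /rho; lra. Qed.

Local Notation geo := (geo_dominated rho).

Implicit Types a b r m f : int -> R.

Lemma moment_seqs_le m k : moment_seqs delta m ->
  `|m k| <= m 0 * rho ^+ `|k|%N.
Proof.
move=> mM; apply: (le_trans (moment_seqs_bound k delta01 mM)).
rewrite ler_wpM2l ?(moment_seqs_ge0 mM)//.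
by have d01 := delta01; rewrite lerXn2r ?nnegrE /rho//; lra.
Qed.

Lemma moment_seqs_geo m : moment_seqs delta m -> geo m.
Proof. by move=> mM; exists (m 0) => k; exact: moment_seqs_le. Qed.

Lemma geo_sqr a : geo a -> geo (fun k => a k ^+ 2).
Proof.
move=> ga; have -> : (fun k => a k ^+ 2) = (fun k => a k * a k).
  by apply/funext => k; rewrite expr2.
by apply: geo_dominatedM => //; exact: geo_dominated_bounded rho01 _ ga.
Qed.

Lemma geo_mul a b : geo a -> geo b -> geo (fun k => a k * b k).
Proof.
move=> ga gb; apply: geo_dominatedM => //.
exact: geo_dominated_bounded rho01 _ gb.
Qed.

Lemma geo_sub a b : geo a -> geo b -> geo (fun k => a k - b k).
Proof.
move=> ga gb; have := geo_dominated_comb 1 (-1) ga gb.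
by under eq_fun do rewrite mul1r mulN1r.
Qed.

Lemma sqnormE a : geo a -> sqnorm a = (zlim (fun k => a k ^+ 2))%:E.
Proof.
move=> ga; rewrite /sqnorm (esum_zlim rho01)//; first exact: geo_sqr.
by move=> k; exact: sqr_ge0.
Qed.

Lemma zfold_sqr_ge0 a n : 0 <= zfold (fun k => a k ^+ 2) n.
Proof. by rewrite addr_ge0// sqr_ge0. Qed.

Lemma series_le_zlim a N : geo a ->
  series (zfold (fun k => a k ^+ 2)) N <= zlim (fun k => a k ^+ 2).
Proof.
move=> ga; apply: nondecreasing_cvgn_le; last exact/(zfold_cvg rho01)/geo_sqr.
by apply: nondecreasing_series => n _ _; exact: zfold_sqr_ge0.
Qed.

(** Turns convergence in norm into pointwise convergence, and a bound on the norm into a bound on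
    the mass. *)
Lemma sqr_le_zlim a k : geo a -> a k ^+ 2 <= zlim (fun k => a k ^+ 2).
Proof.
move=> ga; have [n [E|E]] : exists n, k = Posz n \/ k = Negz n.
  by case: k => n; exists n; [left|right].
all: apply: le_trans (series_le_zlim n.+1 ga); rewrite seriesSr E.
all: rewrite /zfold ler_wpDl// /series/= ?sumr_ge0// => *; rewrite ?zfold_sqr_ge0//.
- by rewrite lerDl sqr_ge0.
- by rewrite lerDr sqr_ge0.
Qed.

Lemma projection_exists r : geo r -> exists m, is_projection delta r m.
Proof.
move=> gr.
pose J m := zlim (fun k => (r k - m k) ^+ 2).
have sJ m : moment_seqs delta m -> sqnorm (r \- m) = (J m)%:E.
  by move=> mM; rewrite sqnormE//; exact: geo_sub gr (moment_seqs_geo mM).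
(* [ell2] can be left out here: moment sequences decay geometrically, hence all lie in it. *)
pose V := [set J m | m in moment_seqs delta].
have M0 : moment_seqs delta (fun=> 0).
  exists mzero; split => // k; rewrite integral_measure_zero//.
have V0 : lbound V 0.
  move=> _ [m mM <-]; rewrite -lee_fin -sJ//.
  by apply: esum_ge0 => k _; rewrite lee_fin sqr_ge0.
have iV : has_inf V by split; [exists (J (fun=> 0)), (fun=> 0)|exists 0].
have I0 : 0 <= inf V by apply: lb_le_inf => //; case: iV.
have leJ m : moment_seqs delta m -> inf V <= J m.
  by move=> mM; apply: ge_inf; [exists 0|exists m].
have min_seq (j : nat) : exists m, moment_seqs delta m /\ J m <= inf V + j.+1%:R^-1.
  have j0 : (0 : R) < j.+1%:R^-1 by rewrite invr_gt0.
  have [_ [m mM <-] /ltW mJ] := inf_adherent j0 iV.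
  by exists m.
have [m_ m_P] := choice min_seq.
have mM j : moment_seqs delta (m_ j) by have [] := m_P j.
have gm j := geo_sub gr (moment_seqs_geo (mM j)).
(* Near-minimality gives [(r 0 - m_ j 0) ^+ 2 <= inf V + 1], whereas a larger mass would make this
   square exceed [(inf V + 2) ^+ 2]. *)
have mB j : m_ j 0 <= r 0 + inf V + 2.
  have [_ /(le_trans (sqr_le_zlim 0 (gm j))) sq_le] := m_P j.
  have j1 : (j.+1%:R^-1 : R) <= 1 by rewrite invf_le1// ler1n.
  rewrite leNgt; apply/negP => rm.
  have : 0 < (m_ j 0 - r 0 - inf V - 2) * (m_ j 0 - r 0 + inf V + 2).
    by rewrite mulr_gt0//; lra.
  have : 0 <= inf V * inf V by rewrite mulr_ge0.
  move: I0 sq_le j1 {rm}; rewrite /= exprS expr1.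
  move: (m_ j 0) (r 0) (inf V) (j.+1%:R^-1) => y z v x.
  nra.
have [U [m [UU ooU mm mcvg]]] := moment_seqs_compact delta01 mM mB.
have gm' := geo_sub gr (moment_seqs_geo mm).
(* Lower semicontinuity as in Fatou's lemma: each partial sum converges along [U], and before the
   limit it is at most [J (m_ j)], eventually at most [inf V + e]. *)
have Jm : J m <= inf V.
  apply: limr_le; first exact/(zfold_cvg rho01)/geo_sqr.
  apply: nearW => N; apply/ler_addgt0Pr => e e0.
  have : series (zfold (fun k => (r k - m_ j k) ^+ 2)) N @[j --> U] -->
      series (zfold (fun k => (r k - m k) ^+ 2)) N.
    apply: cvg_big_sum => n; apply: cvgD; apply: cvg_exprn; apply: cvgB => //;
    exact: cvg_cst.
  move=> /cvgr_to_le; apply; apply: ooU; near=> j.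
  apply: (le_trans (series_le_zlim N (gm j))).
  have [_ /le_trans] := m_P j; apply; rewrite lerD2l ltW//.
  by near: j; exact: near_infty_natSinv_lt (PosNum e0).
exists m; split=> [|m' [m'M _]].
  by split => //; rewrite /ell2/= sqnormE ?ltry//; exact: moment_seqs_geo.
by rewrite !sJ// lee_fin (le_trans Jm)// leJ.
Unshelve. all: by end_near. Qed.

(** Let [e = r - m], [d = f - m], [E = <e, d>] and [D = ||d||^2]. Comparing [m] with
    [(1 - t) m + t f] gives [2 * E <= t * D] for all [t] in []0, 1]], so [E <= 0]; then
    [f - r = d - e] concludes. *)
Lemma projection_ineq r m f : geo r -> is_projection delta r m ->
  moment_seqs delta f ->
  zlim (fun k => (f k - m k) ^+ 2) <= zlim (fun k => (f k - m k) * (f k - r k)).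
Proof.
move=> gr [[mM _] mmin] fM.
have [gm gf] := (moment_seqs_geo mM, moment_seqs_geo fM).
pose e k := r k - m k; pose d k := f k - m k.
have ge : geo e by exact: geo_sub.
have gd : geo d by exact: geo_sub.
have gd2 := geo_sqr gd; have ge2 := geo_sqr ge; have ged := geo_mul ge gd.
pose E := zlim (fun k => e k * d k); pose D := zlim (fun k => d k ^+ 2).
have D0 : 0 <= D by apply: le_trans (sqr_le_zlim 0 gd); exact: sqr_ge0.
have key (t : R) : 0 < t <= 1 -> 2 * E <= t * D.
  move=> t01; pose mt k := (1 - t) * m k + t * f k.
  have mtM : moment_seqs delta mt by apply: moment_seqs_comb => //; lra.
  have : (sqnorm (r \- m)%R <= sqnorm (r \- mt)%R)%E.
    by apply: mmin; split => //; rewrite /ell2/= sqnormE ?ltry//; exact: moment_seqs_geo.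
  rewrite !sqnormE//; last exact: geo_sub gr (moment_seqs_geo mtM).
  rewrite lee_fin.
  have -> : (fun k => (r \- mt) k ^+ 2) =
      (fun k => 1 * (1 * e k ^+ 2 + (- 2 * t) * (e k * d k)) + t ^+ 2 * d k ^+ 2).
    by apply/funext => k; rewrite /= /mt /e /d; ring.
  rewrite !(zlim_comb rho01)//; last exact: geo_dominated_comb.
  rewrite -/E -/D -/(e _) => H.
  have {}H : t * (2 * E) <= t * (t * D) by move: H; rewrite /e/=; lra.
  by move: H; rewrite ler_pM2l//; lra.
have E0 : E <= 0.
  rewrite leNgt; apply/negP => Egt0.
  have den : 0 < E + D + 1 by lra.
  (* In place of a limit as [t] tends to 0, this one value suffices: it gives
     [2 * E <= E * D / (E + D + 1)], impossible for [E > 0]. *)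
  have /key : 0 < E / (E + D + 1) <= 1.
    by rewrite divr_gt0// ler_pdivrMr//; lra.
  rewrite mulrAC ler_pdivlMr//; nra.
have -> : (fun k => (f k - m k) * (f k - r k)) =
    (fun k => 1 * d k ^+ 2 + (- 1) * (e k * d k)).
  by apply/funext => k; rewrite /d /e; ring.
by rewrite (zlim_comb rho01)// -/E -/D -/(d _); lra.
Qed.

(** At [f = 0] the inequality reads [||m||^2 <= <m, r>]. The left side is at least [m 0 ^+ 2]; the
    right side is at most [2 * m 0 * r 0 / (1 - rho)], by the decay of [m] and [|r| <= r 0]. It
    remains to divide by [m 0]. *)
Lemma projection_bound r m : geo r -> (forall k, `|r k| <= r 0) ->
  is_projection delta r m -> m 0 <= 2 * r 0 / (1 - rho).
Proof.
move=> gr r0 mP; have [[mM _] _] := mP; have gm := moment_seqs_geo mM.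
have m0 := moment_seqs_ge0 mM.
have rr0 : 0 <= r 0 by apply: le_trans (r0 0).
have d0 : 0 < 1 - rho by have := rho01; lra.
have M0 : moment_seqs delta (fun=> 0).
  by have := moment_seqs_comb (lexx 0) (lexx 0) mM mM; under eq_fun do rewrite !mul0r addr0.
have := projection_ineq gr mP M0.
have -> : (fun k => (0 - m k) ^+ 2) = (fun k => m k ^+ 2).
  by apply/funext => k; rewrite sub0r sqrrN.
have -> : (fun k => (0 - m k) * (0 - r k)) = (fun k => m k * r k).
  by apply/funext => k; rewrite !sub0r mulrNN.
move=> /(le_trans (sqr_le_zlim 0 gm)).
move=> /le_trans /(_ (ler_norm _)) /le_trans.
have mr k : `|m k * r k| <= m 0 * r 0 * rho ^+ `|k|%N.
  by rewrite normrM mulrAC ler_pM ?moment_seqs_le.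
move=> /(_ _ (zlim_bound rho01 mr)).
have [->|m00] := eqVneq (m 0) 0; first by move=> _; rewrite divr_ge0 ?mulr_ge0// ltW.
rewrite expr2 mulrCA -(mulrA (m 0)) ler_pM2l ?mulrA//.
by rewrite lt_def m00 m0.
Qed.

(** The deterministic part, applied to each path along which the initial estimators converge. *)
Lemma zsum_projection_cvg (r_ : nat -> int -> R) (gamma : int -> R) :
  moment_seqs delta gamma -> (forall M, geo (r_ M)) ->
  (forall M k, `|r_ M k| <= r_ M 0) ->
  (forall k, r_ M k @[M --> \oo] --> gamma k) ->
  zsum (moment_projection delta (r_ M)) @[M --> \oo] --> zsum gamma.
Proof.
move=> gM gr r0 rg.
pose m_ M := moment_projection delta (r_ M).
have mP M : is_projection delta (r_ M) (m_ M).
  by apply: xgetPex; exact: projection_exists.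
have mM M : moment_seqs delta (m_ M) by have [[]] := mP M.
have gg := moment_seqs_geo gM.
have d0 : 0 < 1 - rho by have := rho01; lra.
(* Convergence at index 0 bounds all the [r_ M 0], and through [projection_bound] all the masses
   [m_ M 0]. *)
have [A A0 rA] : exists2 A, 0 <= A & forall M, r_ M 0 <= A.
  have /cvg_seq_bounded[A [_ AP]] : cvgn (fun M => r_ M 0) by exact: cvgP (rg 0).
  exists (`|A| + 1) => [|M]; first by rewrite addr_ge0.
  apply: le_trans (ler_norm _) _; apply: AP => //.
  by rewrite (le_lt_trans (ler_norm A))// ltrDl.
pose B := 2 * A / (1 - rho).
have mB M k : `|m_ M k| <= B * rho ^+ `|k|%N.
  apply: (le_trans (moment_seqs_le k (mM M))).
  rewrite ler_wpM2r ?exprn_ge0//; first by have /andP[/ltW] := rho01.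
  apply: (le_trans (projection_bound (gr M) (r0 M) (mP M))).
  by rewrite ler_pM2r ?invr_gt0// ler_wpM2l.
have dB M k : `|gamma k - m_ M k| <= (gamma 0 + B) * rho ^+ `|k|%N.
  by rewrite (le_trans (ler_normB _ _))// mulrDl lerD// moment_seqs_le.
pose b M k := `|gamma k - m_ M k| * `|gamma k - r_ M k|.
have g0 := moment_seqs_ge0 gM.
have B0 : 0 <= B by rewrite divr_ge0 ?mulr_ge0// ltW.
have rB M k : `|gamma k - r_ M k| <= gamma 0 + A.
  rewrite (le_trans (ler_normB _ _))// lerD//; last exact: le_trans (r0 M k) (rA M).
  apply: le_trans (moment_seqs_le k gM) _; rewrite ler_piMr// exprn_ile1//.
    by have /andP[/ltW] := rho01.
  by have /andP[_ /ltW] := rho01.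
(* The decay comes from [gamma - m_ M] alone; [gamma - r_ M] is only bounded uniformly, since the
   geometric constants of [r_ M] may depend on [M]. *)
have bB M k : `|b M k| <= (gamma 0 + B) * (gamma 0 + A) * rho ^+ `|k|%N.
  by rewrite normrM !normr_id mulrAC ler_pM.
have bcvg k : b M k @[M --> \oo] --> 0.
  apply: (@squeeze_cvgr _ _ _ _ (fun=> 0) (fun M => (gamma 0 + B) * `|gamma k - r_ M k|)).
  - apply: nearW => M; rewrite mulr_ge0//= ler_wpM2r// (le_trans (dB M k))//.
    rewrite ler_piMr ?addr_ge0// exprn_ile1//.
      by have /andP[/ltW] := rho01.
    by have /andP[_ /ltW] := rho01.
  - exact: cvg_cst.
  - rewrite -[X in _ --> X](mulr0 (gamma 0 + B)); apply: cvgM; first exact: cvg_cst.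
    rewrite -(normr0 R) -(subrr (gamma k)); apply: cvg_norm; apply: cvgB => //.
    exact: cvg_cst.
have gb M : geo (b M) by exists ((gamma 0 + B) * (gamma 0 + A)).
have bz : zlim (b M) @[M --> \oo] --> 0.
  have -> : 0 = zlim (fun=> 0 : R).
    apply/esym; rewrite /zlim (_ : series _ = fun=> 0) ?lim_cst//.
    by apply/funext => n; rewrite /series/= big1// => i _; rewrite /zfold addr0.
  exact: (zlim_tannery rho01 bB).
(* The squared error at [k] is at most the squared norm of [gamma - m_ M], which the variational
   inequality bounds by [zlim (b M)]. *)
have mcvg k : m_ M k @[M --> \oo] --> gamma k.
  apply/cvgrPdist_le => e e0.
  have e2 : 0 < e ^+ 2 by rewrite exprn_gt0.
  move/cvgrPdist_le: bz => /(_ _ e2); apply: filterS => M.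
  rewrite sub0r normrN => /(le_trans (ler_norm _)) bMe.
  rewrite -ler_sqr ?nnegrE ?normr_ge0 ?(ltW e0)// real_normK ?num_real//.
  have gd := geo_sub gg (moment_seqs_geo (mM M)).
  apply: le_trans bMe; apply: (le_trans (sqr_le_zlim k gd)).
  apply: (le_trans (projection_ineq (gr M) (mP M) gM)).
  apply: (le_zlim rho01) => //; first exact: geo_mul gd (geo_sub gg (gr M)).
  by move=> j; rewrite /b -normrM ler_norm.
rewrite (zsumE rho01 gg).
under eq_fun do rewrite (zsumE rho01 (moment_seqs_geo (mM _))).
exact: (zlim_tannery rho01 mB).
Qed.

(** Where [|k| < n], [rho ^+ n <= rho ^+ |k|], whence the constant [r 0 / rho ^+ n]. Symmetry
    carries the vanishing over to negative [k]. *)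
Lemma finite_support_geo r (n : nat) : (forall k : int, n%:Z <= k -> r k = 0) ->
  (forall k, r k = r (- k) /\ `|r k| <= r 0) -> geo r.
Proof.
move=> rn r0; have /andP[rho0 rho1] := rho01.
have rr0 : 0 <= r 0 by have [_] := r0 0; exact: le_trans.
exists (r 0 / rho ^+ n) => k.
have [nk|kn] := leqP n `|k|%N.
  suff -> : r k = 0 by rewrite normr0 mulr_ge0 ?divr_ge0 ?exprn_ge0 ?(ltW rho0)//.
  have [k0|k0] := leP 0 k; first by apply: rn; rewrite -(gez0_abs k0) lez_nat.
  have [-> _] := r0 k; apply: rn; rewrite -(ltz0_abs k0) lez_nat//.
have [_ /le_trans] := r0 k; apply.
rewrite -mulrA ler_peMr// mulrC ler_pdivlMr ?exprn_gt0// mul1r.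
by rewrite ler_wiXn2l ?(ltW rho0) ?(ltW rho1)//; exact: ltnW.
Qed.

End projection.

(** * Passage from single paths to the almost sure statement *)

Theorem theorem3 (R : realType) (X : completeMetricType R)
  (hX : separable X)
  (Q : R.-pker (borel X) ~> (borel X))
  (P : probability (borel X) R -> probability (path_space (borel X)) R)
  (hP : forall nu, chain_law Q nu (P nu))
  (psi : {sigma_finite_measure set (borel X) -> \bar R})
  (hirr : psi_irreducible P psi)
  (haper : aperiodic Q psi)
  (hharris : positive_harris_recurrent Q P psi)
  (pi : probability (borel X) R)
  (hrev : reversible Q pi)
  (hgeo : geometrically_ergodic Q pi)
  (g : borel X -> R)
  (gmeas : measurable_fun setT g)
  (gL2 : (\int[pi]_x (g x ^+ 2)%:E < +oo)%E)
  (F : {measure set R -> \bar R})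
  (Fsupp : supported_on F (-1) 1)
  (Frepr : represents F (autocov (P pi) g))
  (delta : R)
  (hdelta : 0 < delta <= 1)
  (Fdelta : supported_on F (-1 + delta) (1 - delta))
  (r : forall M : nat, M.-tuple (borel X) -> int -> R)
  (R1 : forall (x : borel X) (k : int),
     {ae P \d_x, forall w, r M (initial_segment M w) k @[M --> \oo] --> autocov (P pi) g k})
  (n : nat -> nat)
  (R2 : forall (M : nat) (xs : M.-tuple (borel X)) (k : int),
     (n M)%:Z <= k -> r M xs k = 0)
  (R3 : forall (M : nat) (xs : M.-tuple (borel X)) (k : int),
     r M xs k = r M xs (- k) /\ `|r M xs k| <= r M xs 0)
  (x : borel X) :
  {ae P \d_x, forall w,
     zsum (moment_projection delta (r M (initial_segment M w))) @[M --> \oo]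
       --> zsum (autocov (P pi) g)}.
Proof.
have gM : moment_seqs delta (autocov (P pi) g) by exists F.
(* Countably many null sets are merged, first over the nonnegative and then over the negative
   integers. *)
have /ae_foralln rcvg : forall j : nat, {ae P \d_x, forall w,
    r M (initial_segment M w) (Posz j) @[M --> \oo] --> autocov (P pi) g (Posz j)}.
  by move=> j; exact: R1.
have /ae_foralln rcvgN : forall j : nat, {ae P \d_x, forall w,
    r M (initial_segment M w) (Negz j) @[M --> \oo] --> autocov (P pi) g (Negz j)}.
  by move=> j; exact: R1.
apply: filterS2 rcvg rcvgN => w cP cN.
apply: (zsum_projection_cvg hdelta gM).
- by move=> M; apply: (finite_support_geo hdelta (R2 M _)); exact: R3.
- by move=> M k; have [] := R3 M (initial_segment M w) k.
- by case.
Qed.
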